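(* Let $d\ge 2$ and $n\ge 1$ be integers, and let $X$ be a $d$-colored point set in general position in $\mathbb{R}^d$. Suppose that $|X| = (d+1)n$ and that there are at least $n$ points in each of the $d$ color classes. Then $X$ spans $n$ pairwise disjoint $d$-colorful $(d+1)$-islands.
   Context: A finite set in $\mathbb{R}^d$ is in general position if each of its subsets of size at most $d+1$ is affinely independent. A partition of a finite set $X$ into $m$ parts is called an $m$-coloring of $X$; the parts are called color classes, and $X$ is then called $m$-colored (color classes are in general allowed to be empty). A subset $Y\subseteq X$ is $j$-colorful if $Y$ contains points from at least $j$ distinct color classes. For a finite set $X\subset\mathbb{R}^d$ and $Y\subseteq X$, the convex hull $\operatorname{conv} Y$ is called an island spanned by $X$ if $X\cap \operatorname{conv} Y = Y$. It is called a $k$-island if in addition $|Y|=k$, and it is called $j$-colorful if $Y$ is $j$-colorful. Islands are pairwise disjoint if they (that is, the convex hulls) are pairwise disjoint as subsets of $\mathbb{R}^d$. *)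

(* Defs.v *)
From HB Require Import structures.
From mathcomp Require Import all_boot all_order all_algebra.
From mathcomp Require Import finmap.
From mathcomp Require Import boolp classical_sets reals convex.

Set Implicit Arguments.
Unset Strict Implicit.
Unset Printing Implicit Defensive.

Import Order.TTheory GRing.Theory Num.Theory.

Local Open Scope fset_scope.
Local Open Scope classical_set_scope.
Local Open Scope ring_scope.

Section Islands.
Variables (R : realType) (d : nat).
Implicit Types X Y : {fset 'rV[R]_d}.

Definition affinely_independent Y : Prop :=
  forall w : 'rV[R]_d -> R,
    \sum_(y <- Y) w y = 0 -> \sum_(y <- Y) w y *: y = 0 ->
    forall y, y \in Y -> w y = 0.

Definition general_position X : Prop :=
  forall Y, (Y `<=` X)%fset -> (#|` Y| <= d.+1)%N -> affinely_independent Y.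

Definition conv_hull (A : set 'rV[R]_d) : set 'rV[R]_d :=
  smallest (@convex_set R 'rV[R]_d) A.

(* The color classes C i are indexed by 'I_m and may be empty. *)
Definition coloring (m : nat) (C : 'I_m -> {fset 'rV[R]_d}) X : Prop :=
  trivIset setT (fun i => [set` C i]) /\ \bigcup_i [set` C i] = [set` X].

Definition colorful (m j : nat) (C : 'I_m -> {fset 'rV[R]_d}) Y : Prop :=
  (j <= #|[pred i : 'I_m | (C i `&` Y)%fset != fset0]|)%N.

(* Y stands for the island conv_hull [set` Y], whose points of X are exactly Y. *)
Definition island X Y : Prop :=
  (Y `<=` X)%fset /\ [set` X] `&` conv_hull [set` Y] = [set` Y].

Definition k_island (k : nat) X Y : Prop := island X Y /\ #|` Y| = k.

End Islands.

(* Main.v *)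
Require Import Defs.
From mathcomp Require Import all_boot all_order all_algebra.
From mathcomp Require Import finmap.
From mathcomp Require Import boolp classical_sets reals convex.
From mathcomp Require Import perm ring lra zify.

(** The point set is cut into two parts by a hyperplane, and the two parts are
    treated by induction. To find the cut, delete a point from each even color
    class and bisect the resulting odd classes simultaneously: general position
    forces the bisecting hyperplane to contain exactly one point of each class.
    A small perturbation moves these [d] points to prescribed sides, and a
    suitable choice leaves [(d+1) * floor(n/2)] points on one side and enough
    points of every color on both sides.

    The bisecting hyperplane is obtained without topology: the number of
    transversals spanning a bisecting hyperplane is odd for every generic
    configuration of vectors in dimension [d+1]. Its parity does not change when
    a vector moves generically along a segment, because at a moment where [d+1]
    vectors become dependent exactly two transversals can change status, and they
    do so together. Moving all vectors to a standard configuration, where only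
    the transversal of the medians bisects, gives the claim. *)

(** * Orientations of (d+1)-tuples of vectors *)

Section Volumes.
Set Implicit Arguments.
Unset Strict Implicit.
Import Order.TTheory GRing.Theory Num.Theory.
Local Open Scope ring_scope.

Variables (R : realFieldType) (I : finType) (d : nat).
Local Notation V := 'rV[R]_d.+1.
Implicit Types (w : {ffun I -> V}) (f g : {ffun 'I_d.+1 -> I}) (u v : V).
Implicit Types (p q : I) (S : {ffun 'I_d -> I}) (t : R).

Definition rows w f : 'M[R]_d.+1 := \matrix_i w (f i).

Definition vol w f : R := \det (rows w f).

Definition upd w p u : {ffun I -> V} := [ffun q => if q == p then u else w q].

Definition genpos w := forall f, injective f -> vol w f != 0.

Definition im f : {set I} := f @: [set: 'I_d.+1].

(** With [q] in row 0, [vol w (ext S q)] is a linear form in [w q] that vanishes on the span of [S];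
    its sign is the side of this hyperplane on which [q] lies. *)
Definition ext S q : {ffun 'I_d.+1 -> I} :=
  [ffun j => if unlift ord0 j is Some i then S i else q].

Lemma row_rows w f i : row i (rows w f) = w (f i).
Proof. by rewrite rowK. Qed.

Lemma ext0 S q : ext S q ord0 = q.
Proof. by rewrite ffunE unlift_none. Qed.

Lemma extS S q i : ext S q (lift ord0 i) = S i.
Proof. by rewrite ffunE liftK. Qed.

Lemma ext_inj S q : injective S -> (forall i, S i != q) -> injective (ext S q).
Proof.
move=> Sinj Sq a b; case: (unliftP ord0 a) => [i|] ->; last first.
  case: (unliftP ord0 b) => [j|] -> //.
  by rewrite ext0 extS => /eqP; rewrite eq_sym (negbTE (Sq _)).
case: (unliftP ord0 b) => [j|] ->; last first.
  by rewrite ext0 extS => /eqP; rewrite (negbTE (Sq _)).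
by rewrite !extS => /Sinj ->.
Qed.

Lemma mem_im f i : f i \in im f.
Proof. by apply/imsetP; exists i. Qed.

Lemma upd_id w p : upd w p (w p) = w.
Proof. by apply/ffunP=> q; rewrite ffunE; case: eqP => [->|]. Qed.

Lemma vol_upd_const w p u f : p \notin im f -> vol (upd w p u) f = vol w f.
Proof.
move=> pf; congr (\det _); apply/row_matrixP=> i; rewrite !row_rows ffunE.
by case: eqP => // fi; rewrite -fi mem_im in pf.
Qed.

Lemma vol_upd_lin w p u v t f : injective f -> p \in im f ->
  vol (upd w p (u + t *: v)) f = vol (upd w p u) f + t * vol (upd w p v) f.
Proof.
move=> finj /imsetP[i0 _ pE].
rewrite -[vol (upd w p u) f]mul1r; apply: (determinant_multilinear (i0 := i0)).
- by rewrite !row_rows !ffunE pE eqxx scale1r.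
- apply/row_matrixP=> i; apply/rowP=> j; rewrite !mxE !ffunE pE.
  by rewrite (inj_eq finj) eq_sym (negbTE (neq_lift i0 i)).
- apply/row_matrixP=> i; apply/rowP=> j; rewrite !mxE !ffunE pE.
  by rewrite (inj_eq finj) eq_sym (negbTE (neq_lift i0 i)).
Qed.

Lemma vol_upd_segment w p u v t f : injective f ->
  vol (upd w p (u + t *: (v - u))) f =
  vol (upd w p u) f + t * (vol (upd w p v) f - vol (upd w p u) f).
Proof.
move=> finj; have [pf|pf] := boolP (p \in im f); last first.
  by rewrite !vol_upd_const // subrr mulr0 addr0.
rewrite vol_upd_lin // -scaleN1r vol_upd_lin //; ring.
Qed.

(** The tuples differ by a permutation of rows, whose sign does not depend on [w]: orientations of
    [f] and [g] flip together when [w] moves. *)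
Lemma vol_sign f g : injective f -> injective g -> im f = im g ->
  exists b : bool, forall w, vol w f = (-1) ^+ b * vol w g.
Proof.
move=> finj ginj fg.
have sP i : {j | g j = f i}.
  have /imsetP/sig2_eqW[j _ ->] : f i \in im g by rewrite -fg mem_im.
  by exists j.
pose s i := sval (sP i).
have gs i : g (s i) = f i by rewrite /s; case: (sP i).
have sinj : injective s by move=> i j sij; apply: finj; rewrite -!gs sij.
exists (odd_perm (perm sinj)) => w; rewrite -det_perm -det_mulmx -row_permE.
by congr (\det _); apply/matrixP=> i j; rewrite !mxE permE gs.
Qed.

(** The cofactors along row [i0] are those of [A], and [A *m \adj A] is scalar: this is Cramer's
    rule. *)
Lemma det_row_comb n (A B : 'M[R]_n) i0 (l : 'rV_n) :
  row' i0 B = row' i0 A -> row i0 B = l *m A -> \det B = l 0 i0 * \det A.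
Proof.
move=> BA Bl; rewrite (expand_det_row B i0).
have cof j : cofactor B i0 j = cofactor A i0 j.
  congr (_ * \det _); apply/matrixP=> a b; rewrite !mxE.
  by move/matrixP/(_ a (lift j b)): BA; rewrite !mxE.
under eq_bigr do rewrite cof.
have -> : \sum_j B i0 j * cofactor A i0 j = (row i0 B *m \adj A) 0 i0.
  by rewrite mxE; apply: eq_bigr => j _; rewrite !mxE.
by rewrite Bl -mulmxA mul_mx_adj mul_mx_scalar mxE mulrC.
Qed.

Definition swap S i q : {ffun 'I_d -> I} := [ffun j => if j == i then q else S j].

(* When [q] lies on the hyperplane spanned by [S], exchanging it for [S i] spans
   the same hyperplane, so the two linear forms are proportional. *)
Lemma vol_swap w S i q y0 : vol w (ext S q) = 0 -> vol w (ext S y0) != 0 ->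
  exists m, forall y, vol w (ext (swap S i q) y) = m * vol w (ext S y).
Proof.
move=> q0 y0N; pose M y := rows w (ext S y).
pose l := w q *m invmx (M y0).
have lE : w q = l *m M y0 by rewrite mulmxKV // unitmxE unitfE.
have rowS y j : row (lift ord0 j) (M y) = w (S j) by rewrite row_rows extS.
(* By Cramer's rule this coordinate times the nonzero volume of [ext S y0] is the volume of
   [ext S q], which is zero. *)
have l0 : l 0 ord0 = 0.
  apply/eqP; move/eqP: q0; rewrite /vol.
  rewrite (@det_row_comb _ (M y0) _ ord0 l) ?mulf_eq0 ?(negbTE y0N) ?orbF //.
    apply/row_matrixP=> j; apply/rowP=> k; rewrite !mxE.
    by rewrite !(extS _ _ (j : 'I_d)).
  by rewrite row_rows ext0.
(* With coefficient 0 on row 0, the expansion of [w q] involves only [S], so it holds for every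
   [y]. *)
have lM y : w q = l *m M y.
  rewrite lE !mulmx_sum_row !big_ord_recl l0 !scale0r.
  by congr (_ + _); apply: eq_bigr => j _; rewrite !rowS.
exists (l 0 (lift ord0 i)) => y; apply: det_row_comb; last first.
  by rewrite row_rows extS ffunE eqxx (lM y).
apply/row_matrixP=> j; apply/rowP=> k; rewrite !mxE; congr (w _ _ _).
have := neq_lift (lift ord0 i) j.
case: (unliftP ord0 (lift (lift ord0 i) j)) => [a|] ->; last by rewrite !ext0.
by rewrite !extS ffunE (inj_eq lift_inj) eq_sym => /negbTE ->.
Qed.

End Volumes.

(** * Generic perturbations *)

Section Generic.
Set Implicit Arguments.
Unset Strict Implicit.
Import Order.TTheory GRing.Theory Num.Theory.
Local Open Scope ring_scope.

Lemma between_avoiding (R : realFieldType) (s : seq R) (a b : R) : a < b ->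
  exists t, [/\ a < t, t < b & t \notin s].
Proof.
elim: s b => [|x s IH] b ab; first by exists ((a + b) / 2); split=> //; lra.
have [/andP[ax xb]|xN] := boolP (a < x < b).
  have [t [at_ tx ts]] := IH _ ax; exists t; split => //; first exact: lt_trans xb.
  by rewrite in_cons negb_or ts (lt_eqF tx).
have [t [at_ tb ts]] := IH _ ab; exists t; split => //.
by rewrite in_cons negb_or ts andbT; apply: contraNneq xN => <-; rewrite at_ tb.
Qed.

Lemma small_eps (R : realFieldType) (J : eqType) (s : seq J) (a b : J -> R) :
  exists2 e, 0 < e & forall j, j \in s -> a j != 0 -> e * `|b j| < `|a j|.
Proof.
elim: s => [|j s [e e0 IH]]; first by exists 1.
have [aj|aj] := eqVneq (a j) 0.
  by exists e => // k; rewrite in_cons => /orP[/eqP->|/IH//]; rewrite aj eqxx.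
pose e' := `|a j| / (2 * (`|b j| + 1)).
have bj : 0 <= `|b j| by [].
have aj0 : 0 < `|a j| by rewrite normr_gt0.
have e'0 : 0 < e' by rewrite divr_gt0 //; lra.
exists (Order.min e e') => [|k]; first by rewrite lt_min e0.
have min0 : 0 <= Order.min e e' by rewrite le_min !ltW.
rewrite in_cons => /orP[/eqP-> _|/IH/[apply]]; last first.
  by apply: le_lt_trans; rewrite ler_wpM2r // ge_min lexx.
apply: le_lt_trans (_ : e' * `|b j| < _); first by rewrite ler_wpM2r // ge_min lexx orbT.
rewrite /e' mulrAC ltr_pdivrMr; last by lra.
by rewrite ltr_pM2l //; lra.
Qed.

Lemma sgr_perturb (R : realFieldType) (a b e : R) :
  a != 0 -> 0 < e -> e * `|b| < `|a| -> Num.sg (a + e * b) = Num.sg a.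
Proof.
move=> aN e0 lt_ab.
have {lt_ab} : `|e * b| < `|a| by rewrite normrM (gtr0_norm e0).
rewrite ltr_norml => /andP[h1 h2].
case: (ltrgt0P a) aN h1 h2 => [a0|a0|->]; rewrite ?eqxx // => _ h1 h2.
  by rewrite !gtr0_sg //; lra.
by rewrite !ltr0_sg //; lra.
Qed.

Section Forms.
Variables (R : realFieldType) (V : lmodType R) (J : eqType).
Variable l : J -> V -> R.

(** One small step [e] along [v] serves the whole list: nonzero values keep their sign, and a zero
    value becomes [e * l j v]. *)
Lemma form_perturb (s : seq J) z v :
  (forall j, j \in s -> forall t, l j (z + t *: v) = l j z + t * l j v) ->
  exists y, forall j, j \in s ->
    (l j z != 0 -> Num.sg (l j y) = Num.sg (l j z)) /\
    (l j z = 0 -> l j v != 0 -> l j y != 0).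
Proof.
move=> lin; have [e e0 eP] := small_eps s (l^~ z) (l^~ v).
exists (z + e *: v) => j js; rewrite lin //; split=> [lz|-> lv].
  by rewrite sgr_perturb // eP.
by rewrite add0r mulf_neq0 // gt_eqF.
Qed.

Lemma generic_near (s : seq J) :
  (forall j, j \in s -> forall u t v, l j (u + t *: v) = l j u + t * l j v) ->
  (forall j, j \in s -> exists v, l j v != 0) ->
  forall z, exists y, forall j, j \in s ->
    l j y != 0 /\ (l j z != 0 -> Num.sg (l j y) = Num.sg (l j z)).
Proof.
move=> lin lN z.
have sgN (x y : R) : y != 0 -> Num.sg x = Num.sg y -> x != 0.
  by move=> yN xy; rewrite -sgr_eq0 xy sgr_eq0.
(* A direction on which no form vanishes suffices, since [z] can be pushed slightly along it. *)
suff [v vP] : exists v, forall j, j \in s -> l j v != 0.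
  have [|y yP] := @form_perturb s z v; first by move=> j js t; apply: lin.
  exists y => j js; have [h1 h2] := yP j js; split=> //.
  have [lz|lz] := eqVneq (l j z) 0; first exact: h2 (vP _ js).
  exact: sgN (h1 lz).
(* This direction is corrected for one form at a time, by steps too small to undo the earlier
   ones. *)
elim: s lin lN => [|j s IH] lin lN; first by exists 0.
have [||v vP] := IH.
- by move=> k ks; apply: lin; rewrite in_cons ks orbT.
- by move=> k ks; apply: lN; rewrite in_cons ks orbT.
have [v' v'N] := lN j (mem_head _ _).
have [|y yP] := @form_perturb (j :: s) v v'; first by move=> k ks t; apply: lin.
exists y => k ks; have [h1 h2] := yP k ks.
move: ks; rewrite in_cons => /orP[/eqP kj|/vP vN]; last exact: sgN (h1 vN).
subst k; have [lv|lv] := eqVneq (l j v) 0; first exact: h2.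
exact: sgN (h1 lv).
Qed.

End Forms.
End Generic.

(** * Bisecting transversals and their parity *)

Section Bisectors.
Set Implicit Arguments.
Unset Strict Implicit.
Import Order.TTheory GRing.Theory Num.Theory.
Local Open Scope ring_scope.

Variables (R : realFieldType) (I : finType) (d : nat).
Local Notation V := 'rV[R]_d.+1.
Variable C : 'I_d -> {set I}.
Hypothesis Cdisj : forall i j q, q \in C i -> q \in C j -> i = j.
Hypothesis Codd : forall i, odd #|C i|.

Implicit Types (w : {ffun I -> V}) (f g : {ffun 'I_d.+1 -> I}) (u v : V).
Implicit Types (p q : I) (S A B : {ffun 'I_d -> I}) (t : R).

Definition transversal S := forall i, S i \in C i.

Definition above w S i := #|[set q in C i | 0 < vol w (ext S q)]|.

(** Class sizes are odd and [S i] lies on the hyperplane, so in general position half above leaves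
    equally many below. *)
Definition bisects w S := [forall i, (S i \in C i) && (above w S i == #|C i|./2)].

Definition bisectors w : {set {ffun 'I_d -> I}} := finset (bisects w).

Lemma vol_ext_dup w S i : vol w (ext S (S i)) = 0.
Proof.
apply: (determinant_alternate (neq_lift ord0 i)) => j.
by rewrite !mxE ext0 extS.
Qed.

Lemma transversal_inj S : transversal S -> injective S.
Proof. by move=> tS i j Sij; apply: (@Cdisj _ _ (S i)); rewrite ?tS // Sij. Qed.

Lemma transversal_neq S i q : transversal S -> q \in C i -> q != S i ->
  forall j, S j != q.
Proof.
move=> tS qi qS j; apply: contraNneq qS => Sj.
by rewrite (@Cdisj i j q qi) -Sj.
Qed.

Lemma transversal_ext_inj S i q : transversal S -> q \in C i -> q != S i ->
  injective (ext S q).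
Proof.
by move=> tS qi qS; apply: ext_inj; [exact: transversal_inj|exact: transversal_neq qS].
Qed.

Lemma bisectsP w S :
  reflect (transversal S /\ forall i, above w S i = #|C i|./2) (bisects w S).
Proof.
apply: (iffP forallP) => [h|[tS h] i]; last by rewrite tS h eqxx.
by split=> i; have /andP[? /eqP] := h i.
Qed.

Lemma mem_im_ext S q x : (x \in im (ext S q)) = (x == q) || [exists i, x == S i].
Proof.
apply/imsetP/orP => [[j _ ->]|[/eqP->|/existsP[i /eqP->]]].
- case: (unliftP ord0 j) => [i|] ->; rewrite ?ext0 ?extS; last by left.
  by right; apply/existsP; exists i.
- by exists ord0; rewrite ?ext0.
- by exists (lift ord0 i); rewrite ?extS.
Qed.

Lemma im_ext_inj S q i q' : transversal S ->
  q \in C i -> q != S i -> im (ext S q) = im (ext S q') -> q = q'.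
Proof.
move=> tS qi qS eq_im; have : q \in im (ext S q') by rewrite -eq_im mem_im_ext eqxx.
rewrite mem_im_ext => /orP[/eqP//|/existsP[k /eqP qk]].
by have := transversal_neq tS qi qS k; rewrite qk eqxx.
Qed.

Lemma eq_bisects w w' S : (transversal S -> forall i q, q \in C i -> q != S i ->
    (0 < vol w (ext S q)) = (0 < vol w' (ext S q))) ->
  bisects w S = bisects w' S.
Proof.
move=> ww'; have [/forallP tS|tN] := boolP [forall i, S i \in C i]; last first.
  suff F x : bisects x S = false by rewrite !F.
  by apply: contraNF tN => /bisectsP[tS _]; apply/forallP.
apply: eq_forallb => i; congr (_ && (_ == _)); apply: eq_card => q; rewrite !inE.
have [qi|//] := boolP (q \in C i); rewrite /=.
have [->|qS] := eqVneq q (S i); first by rewrite !vol_ext_dup.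
exact: ww' qi qS.
Qed.

Lemma odd_card_symdiff (T : finType) (A B : {set T}) :
  odd #|A| = odd #|B| (+) odd #|(A :\: B) :|: (B :\: A)|.
Proof.
have dis : [disjoint A :\: B & B :\: A].
  by rewrite -finset.setI_eq0; apply/eqP/setP=> x; rewrite !inE; case: (x \in A); rewrite ?andbF.
rewrite -(cardsID B A) -(cardsID A B) cardsU (finset.setIC B A) (disjoint_setI0 dis) cards0.
rewrite subn0 !oddD (finset.setIC A B); set a := odd _; set b := odd _.
by set c := odd _; move: a b c => [] [] [].
Qed.

(* [ws] is the configuration at the moment of the crossing between [w] and
   [w'], when exactly the vectors indexed by [M] become dependent. *)
Section Mutation.
Variables (w w' ws : {ffun I -> V}) (M : {set I}).
Hypothesis off : forall f, injective f -> im f != M -> vol ws f != 0 /\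
  ((0 < vol w f) = (0 < vol ws f)) /\ ((0 < vol w' f) = (0 < vol ws f)).
Hypothesis on : forall f, injective f -> im f = M -> vol ws f = 0 /\
  ((0 < vol w f) = ~~ (0 < vol w' f)).

(** In [ws] the point [q] is on the hyperplane of [S] and is not counted. Every other point keeps
    its side, because only [q] completes [S] to [M]. *)
Lemma above_mutation S i q : transversal S -> q \in C i -> q != S i ->
  im (ext S q) = M ->
  forall j, above w S j = (above ws S j + ((j == i) && (0 < vol w (ext S q))%R))%N /\
            above w' S j = (above ws S j + ((j == i) && (0 < vol w' (ext S q))%R))%N.
Proof.
move=> tS qi qS qM j.
have q0 : vol ws (ext S q) = 0 by apply: (on _ qM).1; apply: transversal_ext_inj qS.
have other x : x \in C j -> x != q -> (0 < vol w (ext S x)) = (0 < vol ws (ext S x)) /\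
    (0 < vol w' (ext S x)) = (0 < vol ws (ext S x)).
  move=> xj xq; have [->|xS] := eqVneq x (S j); first by rewrite !vol_ext_dup.
  apply: (off _ _).2; first exact: transversal_ext_inj xS.
  by apply: contraNneq xq => xM; rewrite (im_ext_inj tS xj xS (etrans xM (esym qM))).
suff main x : (forall y, y \in C j -> y != q ->
      (0 < vol x (ext S y)) = (0 < vol ws (ext S y))) ->
    above x S j = (above ws S j + ((j == i) && (0 < vol x (ext S q))%R))%N.
  by split; apply: main => y yj yq; have [] := other y yj yq.
move=> xP; rewrite /above; have [ji|ji] := eqVneq j i; last first.
  rewrite /= addn0; apply: eq_card => y; rewrite !inE.
  have [yj|//] := boolP (y \in C j); rewrite xP //.
  by apply: contraNneq ji => yq; rewrite (@Cdisj j i q) // -yq.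
rewrite (cardsD1 q) inE ji qi /= addnC; congr (_ + _)%N; apply: eq_card => y.
rewrite !inE; have [->|yq] := eqVneq y q; first by rewrite q0 ltxx andbF.
by rewrite /=; have [yj|//] := boolP (y \in C i); rewrite xP // ji.
Qed.

(** Since [q] is above in exactly one of [w] and [w'], the two counts in class [i] are consecutive,
    and the other counts agree. *)
Lemma toggle S i q : transversal S -> q \in C i -> q != S i ->
  im (ext S q) = M ->
  (bisects w S != bisects w' S) =
  [forall j, (j != i) ==> (above ws S j == #|C j|./2)] &&
  ((above ws S i == #|C i|./2) || (above ws S i + 1 == #|C i|./2)%N).
Proof.
move=> tS qi qS qM; have am := above_mutation tS qi qS qM.
have fl : (0 < vol w (ext S q)) = ~~ (0 < vol w' (ext S q)).
  by apply: (on _ qM).2; apply: transversal_ext_inj qS.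
have bE x : (forall j, above x S j =
      (above ws S j + ((j == i) && (0 < vol x (ext S q))%R))%N) ->
    bisects x S = [forall j, (j != i) ==> (above ws S j == #|C j|./2)] &&
      (above ws S i + (0 < vol x (ext S q))%R == #|C i|./2)%N.
  move=> xP; apply/bisectsP/andP => [[_ h]|[/forallP h1 /eqP h2]].
    split; last by rewrite -h xP eqxx.
    by apply/forallP=> j; apply/implyP=> ji; rewrite -h xP (negbTE ji) addn0.
  split=> // j; rewrite xP; have [->//|ji] := eqVneq j i.
  by rewrite addn0; apply/eqP; apply: (implyP (h1 j)).
rewrite !bE; try by move=> j; have [] := am j.
rewrite fl; case: [forall j, _] => //=; case: (0 < vol w' _) => /=; rewrite addn0;
by do 2![case: eqP => ? //=]; lia.
Qed.

(** The forms of [A] and of its swap differ by the factor [m]. If [m < 0], above and below are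
    exchanged, and what remains of class [j] is its part on the hyperplane: [A j], and also [q] when
    [j = i]. *)
Lemma above_swap A i q m : transversal A -> q \in C i -> q != A i ->
  im (ext A q) = M -> m != 0 ->
  (forall y, vol ws (ext (swap A i q) y) = m * vol ws (ext A y)) ->
  (forall j, above ws (swap A i q) j = above ws A j) \/
  (forall j, above ws (swap A i q) j + above ws A j + (1 + (j == i)) = #|C j|)%N.
Proof.
move=> tA qi qA qM mN mE.
have [m0|m0|m0] := ltrgt0P m; last by rewrite m0 eqxx in mN.
  by left=> j; apply: eq_card => y; rewrite !inE mE pmulr_rgt0.
right=> j; pose sgn e := [set y in C j | Num.sg (vol ws (ext A y)) == e].
have -> : above ws (swap A i q) j = #|sgn (-1)|.
  by apply: eq_card => y; rewrite !inE mE nmulr_rgt0 // sgr_cp0.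
have -> : above ws A j = #|sgn 1| by apply: eq_card => y; rewrite !inE sgr_cp0.
have dup : vol ws (ext A q) = 0 by apply: (on _ qM).1; apply: transversal_ext_inj qA.
have <- : #|sgn 0| = (1 + (j == i))%N.
  have -> : sgn 0 = A j |: (if j == i then [set q] else finset.set0).
    apply/setP=> y; rewrite !inE sgr_eq0.
    have [->|yA] /= := eqVneq y (A j); first by rewrite vol_ext_dup eqxx tA.
    have [yj|yj] /= := boolP (y \in C j); last first.
      have [ji|_] := eqVneq j i; rewrite !inE //.
      by apply/esym; apply: contraNF yj => /eqP->; rewrite ji.
    have [yq|yq] := eqVneq y q.
      subst y; rewrite dup eqxx; have [ji|ji] := eqVneq j i; first by rewrite !inE eqxx.
      by rewrite (Cdisj yj qi) eqxx in ji.
    have -> : (y \in if j == i then [set q] else finset.set0) = false.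
      by case: ifP; rewrite !inE // (negbTE yq).
    apply/negbTE/(off _ _).1; first exact: transversal_ext_inj yA.
    by apply: contraNneq yq => yM; rewrite (im_ext_inj tA yj yA (etrans yM (esym qM))).
  rewrite cardsU1; case: eqVneq => [->|_]; rewrite ?cards1 ?cards0 !inE //.
  by rewrite eq_sym qA.
rewrite -(cardsID (sgn 1) (C j)) -(cardsID (sgn 0) (C j :\: sgn 1)).
have sub e : C j :&: sgn e = sgn e by apply/setP=> y; rewrite !inE andbA andbb.
have -> : (C j :\: sgn 1) :&: sgn 0 = sgn 0.
  apply/setP=> y; rewrite !inE !sgr_cp0.
  by case: (y \in C j); case: ltrgt0P.
have -> : (C j :\: sgn 1) :\: sgn 0 = sgn (-1).
  apply/setP=> y; rewrite !inE !sgr_cp0.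
  by case: (y \in C j); case: ltrgt0P.
rewrite sub; lia.
Qed.

Lemma mutation_parity : odd #|bisectors w| = odd #|bisectors w'|.
Proof.
rewrite (odd_card_symdiff (bisectors w) (bisectors w')).
(* It is enough that [D], the set of transversals changing status, is empty or a pair. *)
set D := _ :|: _; suff -> : odd #|D| = false by rewrite addbF.
have DE S : (S \in D) = (bisects w S != bisects w' S).
  by rewrite !inE; case: (bisects w S); case: (bisects w' S).
(* Only tuples on [M] change sign, so a transversal changing status is completed to [M] by one
   point. *)
have witness S : S \in D -> transversal S /\
    exists i q, [/\ q \in C i, q != S i & im (ext S q) = M].
  rewrite DE => SD.
  have tS : transversal S.
    move: SD; have [/bisectsP[]//|_] := boolP (bisects w S).
    by have [/bisectsP[]//|] := boolP (bisects w' S).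
  split=> //; apply: contraPP SD => noq; apply/negP; rewrite negbK; apply/eqP.
  apply: eq_bisects => _ i q qi qS.
  have SqM : im (ext S q) != M by apply/eqP=> SqM; apply: noq; exists i, q.
  by have [_ [-> ->]] := off (transversal_ext_inj tS qi qS) SqM.
have [->|[A AD]] := set_0Vmem D; first by rewrite cards0.
have [tA [i [q [qi qA qM]]]] := witness A AD.
pose B := swap A i q.
have tB : transversal B by move=> j; rewrite ffunE; case: eqP => [->|].
have Bi : B i = q by rewrite ffunE eqxx.
have BM : im (ext B (A i)) = M.
  rewrite -qM; apply/setP=> x; rewrite !mem_im_ext.
  have [->|xA] := eqVneq x (A i); first by apply/esym/orP; right; apply/existsP; exists i.
  have [->|xq] := eqVneq x q; first by apply/existsP; exists i; rewrite Bi.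
  rewrite /=; apply/existsP/existsP=> -[j /eqP xj]; exists j; apply/eqP.
    by move: xj; rewrite ffunE; case: eqP => // _ xE; rewrite xE eqxx in xq.
  by rewrite ffunE; case: eqP => // ji; rewrite xj ji eqxx in xA.
have AB : A != B by apply: contraNneq qA => AB; rewrite -Bi -AB.
(* [M] has two points of color [i] and one of each other color, so it contains no transversals but
   [A] and [B]. *)
have sub S : S \in D -> S \in [set A; B].
  move=> /[dup] SD /witness[tS [k [x [xk xS xM]]]].
  have SE j : S j = A j \/ (j = i /\ S j = q).
    have : S j \in im (ext A q).
      by rewrite qM -xM mem_im_ext; apply/orP; right; apply/existsP; exists j.
    rewrite mem_im_ext => /orP[/eqP Sj|/existsP[l /eqP Sj]].
      by right; split=> //; apply: (@Cdisj _ _ q) => //; rewrite -Sj.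
    by left; rewrite Sj; congr (A _); apply: (@Cdisj _ _ (A l)) => //; rewrite -Sj.
  rewrite !inE; have [SA|[_ SA]] := SE i; apply/orP; [left|right]; apply/eqP/ffunP=> j.
    by have [//|[-> _]] := SE j.
  have [Sj|[-> Sj]] := SE j; last by rewrite Bi.
  rewrite ffunE; case: eqP => // ji; by rewrite ji SA.
have Aq : A i != B i by rewrite Bi eq_sym.
(* An odd class containing [A i] and [q] has a third point [y]. It lies on neither hyperplane, which
   provides the proportionality and makes [m] nonzero. *)
have [m [mN mE]] : exists m, m != 0 /\
    forall y, vol ws (ext B y) = m * vol ws (ext A y).
  have /set0Pn[y] : C i :\ A i :\ q != finset.set0.
    rewrite -card_gt0; move: (Codd i).
    rewrite (cardsD1 (A i)) (cardsD1 q (C i :\ A i)) tA inE qi inE qA /=.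
    by case: #|_|.
  rewrite !inE => /and3P[yq yA yi].
  have offy S : transversal S -> y != S i -> im (ext S y) != M -> vol ws (ext S y) != 0.
    by move=> tS yS yM; apply: (off _ yM).1; apply: transversal_ext_inj yS.
  have yAN : vol ws (ext A y) != 0.
    apply: offy => //.
    by apply: contraNneq yq => yM; rewrite (im_ext_inj tA yi yA (etrans yM (esym qM))).
  have [m mE] : exists m, forall y, vol ws (ext B y) = m * vol ws (ext A y).
    apply: vol_swap yAN; apply: (on _ qM).1; exact: transversal_ext_inj qA.
  exists m; split=> //; suff : m * vol ws (ext A y) != 0 by apply: contraNneq => ->; rewrite mul0r.
  have yB : y != B i by rewrite Bi.
  rewrite -mE offy //; apply: contraNneq yA => yM.
  by rewrite (im_ext_inj tB yi yB (etrans yM (esym BM))).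
(* The criterion of [toggle] passes from [A] to [B]: for [m < 0], reflection fixes the half count in
   the other classes and, in class [i], exchanges half and half minus one. *)
have BD : B \in D.
  move: AD; rewrite !DE (toggle tA qi qA qM) (toggle tB (tA i) Aq BM).
  have [aE|aE] := above_swap tA qi qA qM mN mE.
    by rewrite aE; under [in X in _ -> X]eq_forallb do rewrite aE.
  case/andP=> /forallP h1 h2; apply/andP; split.
    apply/forallP=> j; apply/implyP=> ji; have := implyP (h1 j) ji.
    have := aE j; have := Codd j; rewrite (negbTE ji) /= /B; lia.
  have := aE i; have := Codd i; rewrite eqxx /= -/B; move: h2; lia.
have -> : D = [set A; B].
  apply/eqP; rewrite finset.eqEsubset; apply/andP; split; apply/fintype.subsetP=> S.
    exact: sub.
  by rewrite !inE => /orP[]/eqP->; [move: AD|move: BD]; rewrite !inE.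
by rewrite cards2 AB.
Qed.
End Mutation.
End Bisectors.

(** * Invariance of the parity when one vector moves *)

Section Parity.
Set Implicit Arguments.
Unset Strict Implicit.
Import Order.TTheory GRing.Theory Num.Theory.
Local Open Scope ring_scope.

Section SegmentSigns.
Variable R : realFieldType.
Implicit Types a b t : R.

Lemma gt0_same a b : 0 < a * b -> (0 < a) = (0 < b).
Proof. by case: (ltrgt0P a) (ltrgt0P b) => ? [] ? h //; exfalso; nra. Qed.

Lemma gt0_opp a b : a * b < 0 -> (0 < a) = ~~ (0 < b).
Proof. by case: (ltrgt0P a) (ltrgt0P b) => ? [] ? h //; exfalso; nra. Qed.

Lemma segment_same a b t : 0 < t < 1 -> 0 < a * b ->
  0 < a * (a + t * (b - a)) /\ 0 < (a + t * (b - a)) * b.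
Proof.
move=> /andP[t0 t1] ab; have aN : a != 0 by apply: contraTneq ab => ->; rewrite mul0r ltxx.
have bN : b != 0 by apply: contraTneq ab => ->; rewrite mulr0 ltxx.
have a2 : 0 < a * a by rewrite -expr2 exprn_even_gt0.
have b2 : 0 < b * b by rewrite -expr2 exprn_even_gt0.
by split; nra.
Qed.

(** [a / (a - b)] is the zero of the affine function [a + t * (b - a)] of [t]. *)
Lemma crossing_time a b : a * b < 0 -> 0 < a / (a - b) < 1.
Proof.
move=> ab; case: (ltrgt0P a) => a0; last by rewrite a0 mul0r ltxx in ab.
  have b0 : b < 0 by nra.
  by rewrite divr_gt0 ?ltr_pdivrMr; lra.
have b0 : 0 < b by nra.
rewrite -[a / _]divrNN divr_gt0 ?ltr_pdivrMr; lra.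
Qed.

Lemma crossingE a b t : a * b < 0 ->
  a + t * (b - a) = (a / (a - b) - t) * (a - b).
Proof.
move=> ab; have abN : a - b != 0.
  by apply: contraTneq ab => /eqP; rewrite subr_eq0 => /eqP->; rewrite -leNgt -expr2 sqr_ge0.
by field.
Qed.

Lemma before_crossing a b t : a * b < 0 -> t < a / (a - b) ->
  0 < a * (a + t * (b - a)).
Proof.
move=> ab tt; rewrite crossingE // mulrCA mulr_gt0 ?subr_gt0 //.
have := sqr_ge0 a; rewrite expr2; nra.
Qed.

Lemma after_crossing a b t : a * b < 0 -> a / (a - b) < t ->
  0 < (a + t * (b - a)) * b.
Proof.
move=> ab tt; rewrite crossingE // -mulrA -mulrNN mulr_gt0 //; first by rewrite opprB subr_gt0.
have := sqr_ge0 b; rewrite expr2; nra.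
Qed.

End SegmentSigns.

Variables (R : realFieldType) (I : finType) (d : nat).
Local Notation V := 'rV[R]_d.+1.
Variable C : 'I_d -> {set I}.
Hypothesis Cdisj : forall i j q, q \in C i -> q \in C j -> i = j.
Hypothesis Codd : forall i, odd #|C i|.

Implicit Types (w : {ffun I -> V}) (f g : {ffun 'I_d.+1 -> I}) (u v z : V).
Implicit Types (p q : I) (S : {ffun 'I_d -> I}).

(* The forms of [f] and [g] vanish at different times along the segment from [u]
   to [v]; cross-multiplied, so that it also makes sense without crossings. *)
Definition distinct_crossings w p u v := forall f g, injective f -> injective g ->
  p \in im f -> p \in im g -> im f != im g ->
  vol (upd w p u) f * vol (upd w p v) g != vol (upd w p v) f * vol (upd w p u) g.

Definition crossings w p u v :=
  [set f : {ffun 'I_d.+1 -> I} | injectiveb f && (vol (upd w p u) f * vol (upd w p v) f < 0)].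

(* Induction on the number of crossings: cut the segment between two distinct
   crossing times. *)
Lemma segment_parity w p u v : genpos (upd w p u) -> genpos (upd w p v) ->
  distinct_crossings w p u v ->
  odd #|bisectors C (upd w p u)| = odd #|bisectors C (upd w p v)|.
Proof.
have [n] := ubnP #|crossings w p u v|.
elim: n u v => // n IH u v len gu gv dist.
pose F f x := vol (upd w p x) f.
have FN f : injective f -> F f u * F f v != 0.
  by move=> fi; rewrite mulf_neq0 ?gu ?gv.
have Fpos f : injective f -> f \notin crossings w p u v -> 0 < F f u * F f v.
  move=> fi; rewrite inE negb_and.
  have -> /= : injectiveb f by apply/injectiveP.
  by rewrite -leNgt le_eqVlt eq_sym (negbTE (FN f fi)).
have [c0|[f0 f0c]] := set_0Vmem (crossings w p u v).
  suff -> : bisectors C (upd w p u) = bisectors C (upd w p v) by [].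
  apply/setP=> S; rewrite !inE; apply: eq_bisects => // tS i q qi qS.
  apply/gt0_same/Fpos; first exact: (transversal_ext_inj Cdisj tS qi qS).
  by rewrite c0 inE.
have /andP[/injectiveP f0i f0lt] : injectiveb f0 && (F f0 u * F f0 v < 0).
  by move: f0c; rewrite inE.
pose tau f := F f u / (F f u - F f v).
have Fseg f t : injective f -> F f (u + t *: (v - u)) = F f u + t * (F f v - F f u).
  by move=> fi; apply: vol_upd_segment.
(* If all crossing tuples share one index set, they cross at the same time and the segment is a
   single mutation. *)
have [all_same|] := boolP [forall f in crossings w p u v, im f == im f0].
  pose z := u + tau f0 *: (v - u).
  apply: (@mutation_parity _ _ _ _ Cdisj Codd _ _ (upd w p z) (im f0)) => f fi fM.
    have fp : 0 < F f u * F f v.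
      apply: Fpos => //; apply: contraNN fM => fc.
      by move/forallP/(_ f)/implyP: all_same; apply.
    have [h1 h2] := segment_same (crossing_time f0lt) fp.
    rewrite -!/(F f _) /z Fseg //; split; last by rewrite (gt0_same h1) -(gt0_same h2).
    by apply: contraTneq h1 => ->; rewrite mulr0 ltxx.
  have [b bE] := vol_sign R fi f0i fM.
  rewrite !bE -!/(F f0 _) /z Fseg // crossingE // subrr mul0r mulr0; split=> //.
  by apply: gt0_opp; rewrite mulrACA -expr2 sqrr_sign mul1r.
rewrite negb_forall => /existsP[g0]; rewrite negb_imply => /andP[g0c gf0].
have /andP[/injectiveP g0i g0lt] : injectiveb g0 && (F g0 u * F g0 v < 0).
  by move: g0c; rewrite inE.
have pim f : injective f -> F f u * F f v < 0 -> p \in im f.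
  move=> fi; apply: contraTT => pf; rewrite /F !vol_upd_const // -leNgt -expr2.
  exact: sqr_ge0.
have subN f : F f u * F f v < 0 -> F f u - F f v != 0.
  by move=> flt; apply: contraTneq flt => /eqP; rewrite subr_eq0 => /eqP->;
     rewrite -leNgt -expr2 sqr_ge0.
have tau_neq : tau f0 != tau g0.
  have := dist f0 g0 f0i g0i (pim _ f0i f0lt) (pim _ g0i g0lt).
  rewrite eq_sym => /(_ gf0); apply: contraNneq => tE.
  have := subN _ f0lt; have := subN _ g0lt; move: tE; rewrite /tau => tE sg sf.
  move/eqP: tE; rewrite eqr_div // => /eqP tE; apply/eqP; rewrite -!/(F _ _); lra.
have [f [g [fi gi flt glt tfg]]] : exists f g, [/\ injective f, injective g,
    F f u * F f v < 0, F g u * F g v < 0 & tau f < tau g].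
  by case: (ltgtP (tau f0) (tau g0)) tau_neq => // tt _; [exists f0, g0|exists g0, f0].
(* Avoiding every crossing time makes the cut point [z] generic. *)
have [t [ft tg tN]] := between_avoiding [seq tau h | h : {ffun 'I_d.+1 -> I}] tfg.
have t01 : 0 < t < 1.
  have /andP[h1 _] := crossing_time flt; have /andP[_ h2] := crossing_time glt.
  by rewrite (lt_trans h1 ft) (lt_trans tg h2).
pose z := u + t *: (v - u).
have gz : genpos (upd w p z).
  move=> h hi; rewrite -/(F h z) Fseg //.
  have [hc|hc] := boolP (h \in crossings w p u v); last first.
    have [h1 _] := segment_same t01 (Fpos h hi hc).
    by apply: contraTneq h1 => ->; rewrite mulr0 ltxx.
  have hlt : F h u * F h v < 0 by move: hc; rewrite inE => /andP[].
  rewrite crossingE // mulf_neq0 ?subN // subr_eq0.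
  by apply: contraNneq tN => <-; apply/mapP; exists h; rewrite ?mem_enum.
have smaller x y k : k \in crossings w p u v -> k \notin crossings w p x y ->
    crossings w p x y \subset crossings w p u v ->
    (#|crossings w p x y| < n)%N.
  move=> kc kN sub; rewrite -ltnS; apply: (leq_ltn_trans _ len); apply: proper_card.
  by apply/properP; split=> //; exists k.
(* The first half no longer crosses [g], the second no longer crosses [f]. Distinctness is
   inherited: the cross differences are multiplied by [t] and by [1 - t]. *)
transitivity (odd #|bisectors C (upd w p z)|).
  apply: IH => //; last first.
    move=> h k hi ki hp kp hk; rewrite -!/(F _ _) !Fseg // -subr_eq0.
    have -> : F h u * (F k u + t * (F k v - F k u)) - (F h u + t * (F h v - F h u)) * F k u
      = t * (F h u * F k v - F h v * F k u) by ring.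
    apply: mulf_neq0; last by rewrite subr_eq0; apply: dist.
    by case/andP: t01 => t0 _; rewrite gt_eqF.
  have fc : g \in crossings w p u v by rewrite inE glt andbT; apply/injectiveP.
  apply: (smaller _ _ g fc).
    rewrite inE negb_and -leNgt -!/(F _ _) Fseg //.
    by rewrite ltW ?orbT // before_crossing.
  apply/fintype.subsetP=> h; rewrite !inE => /andP[hi].
  rewrite hi /= -!/(F _ _) Fseg; last exact/injectiveP.
  move=> h1; have /orP[//|h2] : (F h u * F h v < 0) || (0 < F h u * F h v).
    by rewrite -neq_lt FN //; apply/injectiveP.
  have [h3 _] := segment_same t01 h2; by rewrite ltNge (ltW h3) in h1.
apply: IH => //; last first.
  move=> h k hi ki hp kp hk; rewrite -!/(F _ _) !Fseg // -subr_eq0.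
  have -> : (F h u + t * (F h v - F h u)) * F k v - F h v * (F k u + t * (F k v - F k u))
    = (1 - t) * (F h u * F k v - F h v * F k u) by ring.
  apply: mulf_neq0; last by rewrite subr_eq0; apply: dist.
  by case/andP: t01 => _ t1; rewrite subr_eq0 gt_eqF.
have fc : f \in crossings w p u v by rewrite inE flt andbT; apply/injectiveP.
apply: (smaller _ _ f fc).
  rewrite inE negb_and -leNgt -!/(F _ _) Fseg //.
  by rewrite ltW ?orbT // after_crossing.
apply/fintype.subsetP=> h; rewrite !inE => /andP[hi].
rewrite hi /= -!/(F _ _) Fseg; last exact/injectiveP.
move=> h1; have /orP[//|h2] : (F h u * F h v < 0) || (0 < F h u * F h v).
  by rewrite -neq_lt FN //; apply/injectiveP.
have [_ h3] := segment_same t01 h2; by rewrite ltNge (ltW h3) in h1.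
Qed.


Lemma vol_upd_dup w p q g : injective g -> p \in im g -> q \in im g -> p != q ->
  vol (upd w p (w q)) g = 0.
Proof.
move=> gi /imsetP[a _ pE] /imsetP[b _ qE] pq.
have ab : a != b by apply: contraNneq pq => ab; rewrite pE qE ab.
apply: (determinant_alternate ab) => j; rewrite !mxE !ffunE -pE -qE eqxx.
by rewrite (eq_sym q) (negbTE pq).
Qed.

(** Renaming [p] to [q] in [f] gives an injective tuple with the same rows that avoids [p]. *)
Lemma vol_upd_copy w p q u f : genpos (upd w p u) -> injective f -> q \notin im f ->
  p != q -> vol (upd w p (w q)) f != 0.
Proof.
move=> gu fi qf pq; pose f' : {ffun _} := [ffun i => if f i == p then q else f i].
have fN i : f i != q by apply: contraNneq qf => <-; apply: mem_im.
have -> : vol (upd w p (w q)) f = vol (upd w p u) f'.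
  congr (\det _); apply/row_matrixP=> i; rewrite !row_rows !ffunE.
  by case: (eqVneq (f i) p) => [|fp]; rewrite ?(negbTE fp) // eq_sym (negbTE pq).
apply: gu => i j; rewrite !ffunE.
case: (eqVneq (f i) p) => ip; case: (eqVneq (f j) p) => jp.
- by move=> _; apply: fi; rewrite ip jp.
- by move/eqP; rewrite eq_sym (negbTE (fN j)).
- by move/eqP; rewrite (negbTE (fN i)).
- exact: fi.
Qed.

Lemma im_neq_mem f g : injective f -> injective g -> im f != im g ->
  exists2 q, q \in im f & q \notin im g.
Proof.
move=> fi gi fg; apply/fintype.subsetPn; apply: contraNN fg => sub.
by rewrite finset.eqEcard sub /im (card_imset _ fi) (card_imset _ gi) leqnn.
Qed.

Lemma genposW w p u z : genpos (upd w p u) ->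
  (forall f, injective f -> p \in im f -> vol (upd w p z) f != 0) ->
  genpos (upd w p z).
Proof.
move=> gu zP f fi; have [pf|pf] := boolP (p \in im f); first exact: zP.
by rewrite vol_upd_const // -(vol_upd_const w u pf) gu.
Qed.

(** Several crossings may coincide on the segment from [u] to [v]; a detour through a generic [z]
    separates them. *)
Lemma move_parity w p u v : genpos (upd w p u) -> genpos (upd w p v) ->
  odd #|bisectors C (upd w p u)| = odd #|bisectors C (upd w p v)|.
Proof.
move=> gu gv; pose F f x := vol (upd w p x) f.
pose T : finType := {ffun 'I_d.+1 -> I}.
pose J : finType := (T + bool * (T * T))%type.
pose good f := injectiveb f && (p \in im f).
(* Nonvanishing of the first kind of form makes [z] generic; of the second kind, it separates the
   crossings on the segment joining [z] to [u] or to [v]. *)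
pose l (j : J) (x : V) : R := match j with
  | inl f => F f x
  | inr (b, (f, g)) => let y := if b then u else v in F f y * F g x - F g y * F f x
  end.
pose s := [seq j : J <- enum J | match j with
  | inl f => good f
  | inr (_, (f, g)) => [&& good f, good g & im f != im g]
  end].
have goodP f : good f -> injective f /\ p \in im f.
  by case/andP=> /injectiveP.
have mem_s j : j \in s = match j with
  | inl f => good f
  | inr (_, (f, g)) => [&& good f, good g & im f != im g] end.
  by rewrite mem_filter mem_enum andbT.
have lin j : j \in s -> forall x t y, l j (x + t *: y) = l j x + t * l j y.
  rewrite mem_s; case: j => [f|[b [f g]]].
    by case/goodP=> fi pf x t y; apply: vol_upd_lin.
  case/and3P=> /goodP[fi pf] /goodP[gi pg] _ x t y.
  by rewrite /l /F !vol_upd_lin //; ring.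
have lN j : j \in s -> exists x, l j x != 0.
  rewrite mem_s; case: j => [f|[b [f g]]].
    by case/goodP=> fi pf; exists u; apply: gu.
  case/and3P=> /goodP[fi pf] /goodP[gi pg] fg.
  have [q qf qg] := im_neq_mem fi gi fg.
  have pq : p != q by apply: contraNneq qg => <-.
  (* At [w q] the tuple [f] has two equal rows, so only the term with [F g] survives. *)
  exists (w q); rewrite /l /F (vol_upd_dup w fi) // mulr0 subr0.
  by apply: mulf_neq0; [case: (b); [exact: gu|exact: gv]|exact: vol_upd_copy gu gi qg pq].
have [z zP] := generic_near lin lN u.
have {}zP j : j \in s -> l j z != 0 by move/zP => [].
have good_of f : injective f -> p \in im f -> good f.
  by move=> fi pf; rewrite /good pf andbT; apply/injectiveP.
have gz : genpos (upd w p z).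
  apply: (genposW gu) => f fi pf.
  by apply: (zP (inl f)); rewrite mem_s good_of.
have zP2 b f g : injective f -> injective g -> p \in im f -> p \in im g ->
    im f != im g -> l (inr (b, (f, g))) z != 0.
  by move=> fi gi pf pg fg; apply: zP; rewrite mem_s !good_of.
transitivity (odd #|bisectors C (upd w p z)|); apply: segment_parity => // f g fi gi pf pg fg.
  by have := zP2 true _ _ fi gi pf pg fg; rewrite /l subr_eq0 [F g u * _]mulrC.
have := zP2 false _ _ fi gi pf pg fg; rewrite /l subr_eq0 eq_sym [F g v * _]mulrC.
by rewrite [F f v * _]mulrC [_ * vol _ g]mulrC [_ * F f z]mulrC mulrC.
Qed.

(** * The standard configuration *)

Lemma median (K : {set I}) (r : I -> nat) : injective r -> odd #|K| ->
  exists2 q, q \in K & forall x, x \in K ->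
    (#|[set y in K | (r x < r y)%N]| == #|K|./2) = (x == q).
Proof.
move=> ri Kodd; pose phi x := #|[set y in K | (r x < r y)%N]|.
have phi_lt x y : x \in K -> y \in K -> (r x < r y)%N -> (phi y < phi x)%N.
  move=> xK yK xy; apply: proper_card; apply/properP; split.
    apply/fintype.subsetP=> z; rewrite !inE => /andP[-> yz].
    exact: ltn_trans yz.
  by exists y; rewrite !inE yK // ltnn.
(* [phi] decreases strictly along [r], so it maps [K] bijectively onto the numbers below [#|K|]. *)
have phi_inj : {in K &, injective phi}.
  move=> x y xK yK phixy; apply: ri.
  by have [/(phi_lt _ _ xK yK)|/(phi_lt _ _ yK xK)|//] := ltngtP (r x) (r y);
     rewrite phixy ltnn.
have K0 : (0 < #|K|)%N by case: #|K| Kodd.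
have phi_ub x : x \in K -> (phi x < #|K|)%N.
  move=> xK; apply: proper_card; apply/properP; split.
    by apply/fintype.subsetP=> z; rewrite !inE => /andP[].
  by exists x; rewrite ?inE ?ltnn ?andbF.
have KE := prednK K0; pose psi x : 'I_(#|K|.-1.+1) := inord (phi x).
have psiE x : x \in K -> psi x = phi x :> nat.
  by move=> xK; rewrite inordK // KE phi_ub.
have psi_inj : {in K &, injective psi}.
  by move=> x y xK yK /(congr1 (@nat_of_ord _)); rewrite !psiE //; apply: phi_inj.
have : inord (#|K|./2) \in psi @: K.
  suff -> : psi @: K = finset.setT by rewrite inE.
  apply/eqP; rewrite finset.eqEcard finset.subsetT cardsT card_ord.
  by rewrite (card_in_imset psi_inj) KE leqnn.
case/imsetP=> q qK qE; have {}qE : phi q = #|K|./2.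
  by rewrite -psiE // -qE inordK // KE; lia.
by exists q => // x xK; rewrite -qE -/(phi x) (inj_in_eq phi_inj).
Qed.

(** Color indicators in the last [d] coordinates reduce the side of a point to a comparison of ranks
    within its class. *)
Definition standard : {ffun I -> V} := [ffun q => \row_j
  if unlift ord0 j is Some i then (q \in C i)%:R else (enum_rank q)%:R].

(** The vectors of [q] and [S i] differ only in coordinate 0. Linearity in row 0 leaves a repeated
    row plus [c] times the unitriangular determinant of [D]. *)
Lemma vol_standard S i q : transversal C S -> q \in C i ->
  vol standard (ext S q) = (enum_rank q)%:R - (enum_rank (S i))%:R.
Proof.
move=> tS qi; set c := (RHS).
have mem_C j x k : x \in C j -> (x \in C k) = (k == j).
  move=> xj; apply/idP/eqP => [xk|->//]; exact: Cdisj xj.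
have lift_rshift (k : 'I_d) : lift ord0 k = rshift 1 k by apply: val_inj.
pose T : 'M[R]_(d, 1) := \col_j (enum_rank (S j))%:R.
have [D [detD D00 D0S DS]] : exists D : 'M[R]_d.+1, [/\ \det D = 1,
    D ord0 ord0 = 1, forall k, D ord0 (lift ord0 k) = 0 &
    forall j, row (lift ord0 j) D = standard (S j)].
  exists (block_mx 1%:M 0 T 1%:M : 'M[R]_(1 + d)).
  have o0 : ord0 = lshift d ord0 :> 'I_(1 + d) by apply: val_inj.
  split.
  - by apply: (etrans (det_lblock 1%:M T 1%:M)); rewrite !det1 mulr1.
  - by rewrite o0; apply: (etrans (block_mxEul _ _ _ _ _ _)); rewrite mxE.
  - by move=> k; rewrite lift_rshift o0; apply: (etrans (block_mxEur _ _ _ _ _ _)); rewrite mxE.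
  move=> j; apply/rowP=> k; rewrite [LHS]mxE ffunE [RHS]mxE lift_rshift.
  case: (unliftP ord0 k) => [k'|] ->.
    rewrite lift_rshift; apply: (etrans (block_mxEdr _ _ _ _ _ _)).
    by rewrite mxE (mem_C _ _ _ (tS j)) eq_sym.
  by rewrite o0; apply: (etrans (block_mxEdl _ _ _ _ _ _)); rewrite mxE.
have := @determinant_multilinear _ _ (rows standard (ext S q))
  (rows standard (ext S (S i))) D ord0 1 c.
rewrite detD -!/(vol _ _) vol_ext_dup mul1r mulr1 add0r; apply.
- rewrite scale1r !row_rows !ext0; apply/rowP=> j; rewrite !mxE !ffunE !mxE.
  case: (unliftP ord0 j) => [k|] ->.
    by rewrite D0S mulr0 addr0 (mem_C _ _ _ qi) (mem_C _ _ _ (tS i)).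
  by rewrite D00 /c mulr1; ring.
- apply/row_matrixP=> j; apply/rowP=> k; rewrite !mxE; congr (fun_of_matrix (standard _)).
  by rewrite !(extS _ _ (j : 'I_d)).
- apply/row_matrixP=> j; have /rowP Dj := DS j; apply/rowP=> k.
  by have := Dj k; rewrite !mxE (extS _ _ (j : 'I_d)) => ->.
Qed.

Lemma bisectors_standard : #|bisectors C standard| = 1%N.
Proof.
have rank_inj : injective (fun x : I => enum_rank x : nat).
  by move=> x y /val_inj/enum_rank_inj.
have /fin_all_exists2[q qC qP] i := median rank_inj (Codd i).
have -> : bisectors C standard = [set finfun q].
  apply/setP=> S; rewrite !inE; apply/bisectsP/eqP => [[tS h]|->].
    apply/ffunP=> i; rewrite ffunE; apply/eqP; rewrite -qP // -h; apply/eqP.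
    apply: eq_card => x; rewrite !inE; have [xi|//] /= := boolP (x \in C i).
    by rewrite (vol_standard tS xi) subr_gt0 ltr_nat.
  have tS : transversal C (finfun q) by move=> i; rewrite ffunE.
  split=> // i; apply/eqP; rewrite -[X in _ == X./2]/(#|C i|).
  have := qP i _ (qC i); rewrite eqxx => /eqP <-; apply/eqP; apply: eq_card => x.
  rewrite !inE; have [xi|//] /= := boolP (x \in C i).
  by rewrite (vol_standard tS xi) subr_gt0 ltr_nat ffunE.
exact: cards1.
Qed.

(* The vectors are replaced one at a time: [x] starts at [w], [y] at the standard
   configuration, and each step moves [x p] and [y p] to a common vector, generic
   for [x] and so close to [y p] that no relevant sign of [y] changes. *)
Theorem bisectors_odd w : genpos w -> odd #|bisectors C w|.
Proof.
(* [y] is not asked to be generic: it only keeps the signs that decide bisection, which are nonzero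
   for [standard]. *)
move=> gw; pose same y := forall S i q, transversal C S -> q \in C i -> q != S i ->
  Num.sg (vol y (ext S q)) = Num.sg (vol standard (ext S q)).
have standardN S i q : transversal C S -> q \in C i -> q != S i ->
    vol standard (ext S q) != 0.
  move=> tS qi qS; rewrite (vol_standard tS qi) subr_eq0 eqr_nat.
  by rewrite (inj_eq val_inj) (inj_eq enum_rank_inj).
suff [x [y [gx xw sy xy]]] : exists x y, [/\ genpos x,
    odd #|bisectors C x| = odd #|bisectors C w|, same y &
    forall q, q \in enum I -> x q = y q].
  have {}xy : x = y by apply/ffunP=> q; rewrite xy ?mem_enum.
  rewrite -xw xy; suff -> : bisectors C y = bisectors C standard.
    by rewrite bisectors_standard.
  apply/setP=> S; rewrite !inE; apply: eq_bisects => tS i q qi qS.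
  by rewrite -sgr_gt0 (sy S i) // sgr_gt0.
elim: (enum I) => [|p s [x [y [gx xw sy xy]]]]; first by exists w, standard; split.
pose T : finType := {ffun 'I_d.+1 -> I}.
pose J : finType := (bool * T)%type.
pose l (j : J) z := vol (upd (if j.1 then x else y) p z) j.2.
(* All forms of [x] must become nonzero, whereas for [y] only the forms already nonzero are
   controlled. *)
pose sJ := [seq j : J <- enum J |
  [&& injectiveb j.2, p \in im j.2 & j.1 || (vol y j.2 != 0)]].
have mem_s j : j \in sJ =
    [&& injectiveb j.2, p \in im j.2 & j.1 || (vol y j.2 != 0)].
  by rewrite mem_filter mem_enum andbT.
have [|j|z zP] := @generic_near _ _ _ l sJ _ _ (y p).
- move=> j; rewrite mem_s => /and3P[/injectiveP fi pf _] u t v.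
  exact: vol_upd_lin.
- rewrite mem_s => /and3P[/injectiveP fi pf]; case: j fi pf => [[] f] /= fi pf yN.
    by exists (x p); rewrite /l /= upd_id gx.
  by exists (y p); rewrite /l /= upd_id.
exists (upd x p z), (upd y p z).
have gz : genpos (upd x p z).
  apply: (@genposW x p (x p)); rewrite ?upd_id // => f fi pf.
  have /injectiveP fib := fi.
  by have [] := zP (true, f); rewrite ?mem_s //= fib pf.
split=> //.
- rewrite -xw -{2}(upd_id x p); apply: move_parity => //.
  by rewrite upd_id.
- move=> S i q tS qi qS; have fi := transversal_ext_inj Cdisj tS qi qS.
  have [pf|pf] := boolP (p \in im (ext S q)); last by rewrite vol_upd_const // (sy S i).
  have yN : vol y (ext S q) != 0 by rewrite -sgr_eq0 (sy S i) // sgr_eq0 (standardN S i).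
  have /injectiveP fib := fi.
  have [|_] := zP (false, ext S q); first by rewrite mem_s /= fib pf yN.
  by rewrite /l /= upd_id => ->; rewrite ?(sy S i).
- move=> q; rewrite in_cons !ffunE; case: eqP => //= _; exact: xy.
Qed.

End Parity.

(** * Splitting a colored point set *)

Section Splitting.
Set Implicit Arguments.
Unset Strict Implicit.
Import Order.TTheory GRing.Theory Num.Theory.
Local Open Scope ring_scope.

(** A discrete intermediate value argument: starting from [lo], raise one entry by one at a time. *)
Lemma interpolate_sum (T : finType) (lo hi : T -> nat) m :
  (forall i, lo i <= hi i)%N -> (\sum_i lo i <= m <= \sum_i hi i)%N ->
  exists2 a : T -> nat, (forall i, lo i <= a i <= hi i)%N & (\sum_i a i)%N = m.
Proof.
move=> lohi /andP[/subnKC <-]; elim: (m - _)%N => [|k IH] ub.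
  by exists lo => [i|]; rewrite ?leqnn ?lohi ?addn0.
have [|a aP aE] := IH; first by apply: leq_trans ub; rewrite leq_add2l.
have [/existsP[i ai]|/existsPn aN] := boolP [exists i, a i < hi i]%N; last first.
  suff : (\sum_i hi i <= \sum_i a i)%N by rewrite aE; lia.
  by apply: leq_sum => i _; rewrite leqNgt aN.
exists (fun j => a j + (j == i))%N => [j|].
  by have := aP j; case: eqP => [->|]; lia.
have one : (\sum_j (j == i) = 1)%N.
  by rewrite (bigD1 i) //= eqxx big1 ?addn0 // => j /negbTE ->.
by rewrite big_split /= aE one addn1 addnS.
Qed.

(* [P i] and [N i] count the points of color [i] strictly on either side of a
   halving hyperplane, and [T] is the set of colors whose point on the
   hyperplane joins the side counted by [P]. *)
Lemma choose_sides d n (P N : 'I_d -> nat) :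
  (forall i, P i <= N i + 1 /\ N i <= P i + 1)%N ->
  (forall i, n <= P i + N i + 1)%N ->
  (\sum_i (P i + N i + 1) = d.+1 * n)%N ->
  (\sum_i P i <= \sum_i N i)%N ->
  exists T : {set 'I_d},
    (forall i, n./2 <= P i + (i \in T) /\ uphalf n <= N i + (i \notin T))%N /\
    (\sum_i (P i + (i \in T)) = d.+1 * n./2)%N.
Proof.
move=> PN big total le_PN.
have nE : (n = n./2 + uphalf n)%N by rewrite addnC uphalf_half; lia.
have uE : uphalf n = (odd n + n./2)%N by rewrite uphalf_half.
(* [lo] adds the point only where the positive side lacks it; [hi] adds it wherever the negative
   side can spare it. *)
pose lo i := (P i + (P i < n./2))%N; pose hi i := (P i + (uphalf n <= N i))%N.
have lohi i : (lo i <= hi i)%N by have := PN i; have := big i; rewrite /lo /hi; lia.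
have [|a aP aE] := @interpolate_sum _ lo hi (d.+1 * n./2)%N lohi.
  have sumD : (\sum_i (P i + N i + 1) = \sum_i P i + \sum_i N i + d)%N.
    by rewrite !big_split /= sum_nat_const card_ord muln1.
  apply/andP; split.
    (* For odd [n] balance forces no addition, and the comparison of the sums gives the bound; for
       even [n] it holds color by color. *)
    have [on|en] := boolP (odd n).
      have -> : (\sum_i lo i = \sum_i P i)%N.
        by apply: eq_bigr => i _; have := PN i; have := big i; rewrite /lo; lia.
      nia.
    suff : (\sum_i (lo i + lo i) <= \sum_i (P i + N i + 1))%N by rewrite big_split /= total; nia.
    by apply: leq_sum => i _; have := PN i; have := big i; rewrite /lo; lia.
  suff : (\sum_i (P i + N i + 1) <= \sum_i (hi i + hi i + odd n))%N.
    rewrite total !big_split /= sum_nat_const card_ord; case: (odd n) nE uE; nia.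
  by apply: leq_sum => i _; have := PN i; have := big i; rewrite /hi; lia.
exists [set i | P i < a i]%N.
have aT i : (P i + (i \in [set i | P i < a i]) = a i)%N.
  by rewrite inE; have := aP i; rewrite /lo /hi; lia.
split; last by rewrite -aE; apply: eq_bigr => i _; rewrite aT.
move=> i; have := aT i; have := aP i; have := PN i; have := big i.
by rewrite /lo /hi; case: (i \in _) => /=; lia.
Qed.

(** * Halving hyperplanes and their perturbation *)

Section Halving.
Variables (R : realFieldType) (I : finType) (d : nat).
Local Notation V := 'rV[R]_d.+1.
Implicit Types (w : {ffun I -> V}) (S : {ffun 'I_d -> I}) (a b : 'cV[R]_d.+1).
Implicit Types (q : I).

Definition val_form w a q : R := (w q *m a) 0 0.

(** Expand along row 0: the cofactors depend on [S] alone. *)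
Lemma vol_form w S : exists a, forall q, vol w (ext S q) = val_form w a q.
Proof.
pose M := \matrix_i (if unlift ord0 i is Some k then w (S k) else 0) : 'M[R]_d.+1.
exists (\col_j cofactor M ord0 j) => q.
rewrite /vol (expand_det_row _ ord0) /val_form mxE; apply: eq_bigr => j _.
rewrite !mxE ext0; congr (_ * (_ * \det _)); apply/matrixP=> x y.
by rewrite !mxE liftK (extS _ _ (x : 'I_d)).
Qed.

(** [S] and [z] give a basis, so values on [S] can be prescribed; this allows independent tilting at
    each point of the hyperplane. *)
Lemma dual_form w S z (e : 'I_d -> R) : vol w (ext S z) != 0 ->
  exists b, forall i, val_form w b (S i) = e i.
Proof.
move=> zN; pose M := rows w (ext S z).
pose ec : 'cV[R]_d.+1 := \col_j if unlift ord0 j is Some i then e i else 0.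
exists (invmx M *m ec) => i.
rewrite /val_form (_ : w (S i) = row (lift ord0 i) M); last by rewrite row_rows extS.
rewrite -row_mul mulmxA mulmxV ?unitmxE ?unitfE // mul1mx.
by rewrite !mxE liftK.
Qed.

Variable c : I -> 'I_d.

Definition pos_class w a i := [set q | (c q == i) && (0 < val_form w a q)].

Definition neg_class w a i := [set q | (c q == i) && (val_form w a q < 0)].

Lemma val_formN w a q : val_form w (- a) q = - val_form w a q.
Proof. by rewrite /val_form mulmxN mxE. Qed.

(* An even class is first made odd by deleting one of its points, so that the
   bisecting hyperplane meets every class in exactly one point. *)
Lemma halving_form w : genpos w -> (d < #|I|)%N ->
  (forall i, exists q, c q = i) ->
  exists S a, [/\ forall i, c (S i) = i,
    forall q, (val_form w a q == 0) = (q == S (c q)),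
    forall i, (#|pos_class w a i| <= #|neg_class w a i| + 1 /\
               #|neg_class w a i| <= #|pos_class w a i| + 1 /\
               #|pos_class w a i| + #|neg_class w a i| + 1 = #|[set q | c q == i]|)%N &
    forall e : 'I_d -> R, exists b, forall i, val_form w b (S i) = e i].
Proof.
move=> gw dI /fin_all_exists[x xE].
pose K i := [set q | c q == i].
pose C i := if odd #|K i| then K i else K i :\ x i.
have CK i q : q \in C i -> c q = i.
  by rewrite /C; case: ifP => _; rewrite !inE; [move/eqP|case/andP=> _ /eqP].
have Codd i : odd #|C i|.
  rewrite /C; case: ifP => // /negbT; rewrite (cardsD1 (x i)) inE xE eqxx /=.
  by rewrite negbK.
have Cdisj i j q : q \in C i -> q \in C j -> i = j by move=> /CK <- /CK.
have := bisectors_odd Cdisj Codd gw; case: (set_0Vmem (bisectors C w)) => [->|[S]].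
  by rewrite cards0.
rewrite inE => /bisectsP[tS aS] _; have [a aE] := vol_form w S.
have cS i : c (S i) = i := CK _ _ (tS i).
have zeroP q : (val_form w a q == 0) = (q == S (c q)).
  rewrite -aE; have [->|qS] := eqVneq q (S (c q)); first by rewrite vol_ext_dup eqxx.
  apply/negbTE/gw/(ext_inj (transversal_inj Cdisj tS)) => i.
  by apply: contraNneq qS => <-; rewrite cS.
exists S, a; split=> //.
- move=> i; have KE : #|K i| = (#|pos_class w a i| + #|neg_class w a i| + 1)%N.
    have -> : K i = pos_class w a i :|: neg_class w a i :|: [set S i].
      apply/setP=> q; rewrite !inE; have [cq|cq] := eqVneq (c q) i; last first.
        by apply/esym/negbTE; apply: contraNneq cq => ->; rewrite cS.
      by rewrite -cq -zeroP /=; case: ltrgt0P.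
    rewrite cardsU [X in (_ - X)%N](_ : _ = 0)%N ?subn0; last first.
      apply/eqP; rewrite cards_eq0; apply/eqP/setP=> q; rewrite !inE.
      have [->|] := eqVneq q (S i); last by rewrite andbF.
      have /eqP-> : val_form w a (S i) == 0 by rewrite zeroP cS.
      by rewrite ltxx !andbF.
    rewrite cardsU [X in (_ - X)%N](_ : _ = 0)%N ?subn0 ?cards1 //.
    apply/eqP; rewrite cards_eq0; apply/eqP/setP=> q; rewrite !inE.
    by case: ltrgt0P; rewrite ?andbF.
  (* Restoring the deleted point of an even class adds at most one to the positive side. *)
  have : (above C w S i <= #|pos_class w a i| <= above C w S i + ~~ odd #|K i|)%N.
    rewrite /above /C; case: ifP => oK.
      rewrite addn0 -eqn_leq; apply/eqP/eq_card => q.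
      by rewrite !inE aE.
    rewrite (cardsD1 (x i) (pos_class _ _ _)).
    have -> : #|[set q in K i :\ x i | 0 < vol w (ext S q)]| = #|pos_class w a i :\ x i|.
      by apply: eq_card => q; rewrite !inE aE andbA.
    by case: (_ \in _); lia.
  have CE : #|C i| = (#|K i| - ~~ odd #|K i|)%N.
    rewrite /C; case: ifP => oK; rewrite ?subn0 //.
    by rewrite (cardsD1 (x i) (K i)) inE xE eqxx addnC addnK.
  rewrite (aS i) CE -/(K i) KE; lia.
have [z zN] : exists z, z \notin codom S.
  apply/existsP; rewrite -negb_forall; apply: contraL dI => /forallP all_in.
  rewrite -leqNgt -(card_ord d); apply: leq_trans (leq_image_card S _).
  by apply/subset_leq_card/fintype.subsetP=> q _; apply: all_in.
move=> e; apply: (@dual_form _ _ z); rewrite aE zeroP.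
by apply: contraNneq zN => ->; apply: codom_f.
Qed.

Lemma splitting_form w n : genpos w -> (0 < n)%N -> #|I| = (d.+1 * n)%N ->
  (forall i, n <= #|[set q | c q == i]|)%N ->
  exists a, [/\ forall q, val_form w a q != 0,
    #|[set q | 0 < val_form w a q]| = (d.+1 * n./2)%N &
    forall i, (n./2 <= #|pos_class w a i| /\ uphalf n <= #|neg_class w a i|)%N].
Proof.
move=> gw n0 cardI cls.
have [||S [a [cS aS bal dual]]] := halving_form gw.
- by rewrite cardI; nia.
- move=> i; have := leq_trans n0 (cls i); rewrite card_gt0.
  by case/set0Pn=> q; rewrite inE => /eqP <-; exists q.
(* Negating [a] exchanges the sides, so the positive one may be taken as the smaller. *)
wlog le_sum : a aS bal / (\sum_i #|pos_class w a i| <= \sum_i #|neg_class w a i|)%N.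
  have posN i : pos_class w (- a) i = neg_class w a i.
    by apply/setP=> q; rewrite !inE val_formN oppr_gt0.
  have negN i : neg_class w (- a) i = pos_class w a i.
    by apply/setP=> q; rewrite !inE val_formN oppr_lt0.
  move=> wl; have [|/ltnW le] := leqP (\sum_i #|pos_class w a i|)%N (\sum_i #|neg_class w a i|)%N.
    exact: wl.
  apply: (wl (- a)) => [q|i|]; first by rewrite val_formN oppr_eq0 aS.
    by rewrite posN negN; have := bal i; lia.
  by under eq_bigr do rewrite posN; under [X in (_ <= X)%N]eq_bigr do rewrite negN.
have total : (\sum_i (#|pos_class w a i| + #|neg_class w a i| + 1) = d.+1 * n)%N.
  rewrite -cardI; under eq_bigr do rewrite (bal _).2.2 -sum1_card.
  rewrite -sum1_card (partition_big c xpredT) //=.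
  by apply: eq_bigr => i _; apply: eq_bigl => q; rewrite inE.
have [||T [TP TE]] := choose_sides _ _ total le_sum.
- by move=> i; have [? [? _]] := bal i.
- by move=> i; rewrite (bal i).2.2.
(* A small multiple of [b] sends the points on the hyperplane with color in [T] to the positive side
   and the others to the negative side. *)
have [b bE] := dual (fun i => if i \in T then 1 else -1).
have [e e0 eP] := small_eps (enum I) (val_form w a) (val_form w b).
have a0 i : val_form w a (S i) = 0 by apply/eqP; rewrite aS cS.
pose f := a + e *: b.
have fE q : val_form w f q = val_form w a q + e * val_form w b q.
  by rewrite /val_form mulmxDr -scalemxAr !mxE.
have fS i : val_form w f (S i) = e * (if i \in T then 1 else -1).
  by rewrite fE bE a0 add0r.
have fN q : q != S (c q) -> Num.sg (val_form w f q) = Num.sg (val_form w a q).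
  by rewrite -aS => aN; rewrite fE sgr_perturb // eP ?mem_enum.
have fSg q : (0 < val_form w f q) = (0 < val_form w a q) || ((q == S (c q)) && (c q \in T)).
  have [qS|qS] := eqVneq q (S (c q)); last by rewrite orbF -sgr_gt0 fN // sgr_gt0.
  have aq : val_form w a q = 0 by apply/eqP; rewrite aS -qS.
  by rewrite aq ltxx qS fS cS; case: ifP; rewrite ?mulr1 // mulrN1 oppr_gt0 ltNge ltW.
have fSl q : (val_form w f q < 0) = (val_form w a q < 0) || ((q == S (c q)) && (c q \notin T)).
  have [qS|qS] := eqVneq q (S (c q)); last by rewrite orbF -sgr_lt0 fN // sgr_lt0.
  have aq : val_form w a q = 0 by apply/eqP; rewrite aS -qS.
  by rewrite aq ltxx qS fS cS; case: ifP; rewrite ?mulr1 ?mulrN1 ?oppr_lt0 //= ltNge ltW.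
have posE i : #|pos_class w f i| = (#|pos_class w a i| + (i \in T))%N.
  rewrite (cardsD1 (S i)) inE cS eqxx fSg cS eqxx /=.
  have -> : 0 < val_form w a (S i) = false by rewrite a0 ltxx.
  rewrite addnC; congr (_ + _)%N; apply: eq_card => q; rewrite !inE fSg.
  have [<-|] := eqVneq (c q) i; rewrite ?andbF //= -aS.
  by case: ltrgt0P.
have negE i : #|neg_class w f i| = (#|neg_class w a i| + (i \notin T))%N.
  rewrite (cardsD1 (S i)) inE cS eqxx fSl cS eqxx /=.
  have -> : val_form w a (S i) < 0 = false by rewrite a0 ltxx.
  rewrite addnC; congr (_ + _)%N; apply: eq_card => q; rewrite !inE fSl.
  have [<-|] := eqVneq (c q) i; rewrite ?andbF //= -aS.
  by case: ltrgt0P.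
exists f; split.
- move=> q; rewrite neq_lt fSg fSl; have := aS q.
  by case: ltrgt0P => //= _ <-; case: (c q \in T).
- rewrite -TE -sum1_card (partition_big c xpredT) //=; apply: eq_bigr => i _.
  by rewrite -posE -sum1_card; apply: eq_bigl => q; rewrite !inE andbC.
- by move=> i; rewrite posE negE; apply: TP.
Qed.

End Halving.

(** * From vectors back to points: homogenization, convex hulls and the induction *)

Variables (R : realType) (d : nat).
Local Notation V := 'rV[R]_d.
Implicit Types (x y : V) (X Y : {fset V}).

Definition homog x : 'rV[R]_d.+1 := \row_j if unlift ord0 j is Some i then x 0 i else 1.

Lemma general_position_genpos X : general_position X ->
  genpos [ffun q : X => homog (val q)].
Proof.
move=> gX f fi; apply/negP => /det0P[v vN vM].
have vf j : \sum_i v 0 i * homog (val (f i)) 0 j = 0.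
  move/rowP/(_ j): vM; rewrite !mxE => vMj; rewrite -[RHS]vMj.
  by apply: eq_bigr => i _; rewrite !mxE ffunE mxE.
pose s := [seq val (f i) | i <- enum 'I_d.+1].
pose Y := [fset y in s]%fset.
have fY i : val (f i) \in Y by rewrite inE; apply: map_f; rewrite mem_enum.
(* The coefficients of a linear dependence become weights on points: coordinate 0 makes their sum
   vanish, the other coordinates the weighted sum of points. *)
pose wt y := \sum_(i | val (f i) == y) v 0 i.
have sumY (W : lmodType R) (G : V -> W) :
    \sum_(y <- Y) wt y *: G y = \sum_i v 0 i *: G (val (f i)).
  under eq_bigr do rewrite scaler_suml.
  rewrite (exchange_big_dep xpredT) //=; apply: eq_bigr => i _.
  rewrite big_mkcond (bigD1_seq (val (f i))) ?fset_uniq ?fY //= eqxx big1 ?addr0 // => y.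
  by rewrite eq_sym => /negbTE ->.
have wt0 : forall y, y \in Y -> wt y = 0.
  apply: gX.
  - by apply/fsubsetP=> y; rewrite inE => /mapP[i _ ->]; exact: valP.
  - by rewrite card_fseq (leq_trans (size_undup _)) // size_map size_enum_ord.
  - have scale1 (a : R) : a *: (1 : R^o) = a by rewrite /GRing.scale /= mulr1.
    transitivity (\sum_(y <- Y) wt y *: (1 : R^o)).
      by apply: eq_bigr => y _; rewrite scale1.
    rewrite sumY -[RHS](vf ord0); apply: eq_bigr => i _.
    by rewrite scale1 mxE unlift_none mulr1.
  - rewrite sumY; apply/rowP=> j; rewrite summxE mxE -[RHS](vf (lift ord0 j)).
    by apply: eq_bigr => i _; rewrite !mxE liftK.
case/eqP: vN; apply/rowP=> i; rewrite mxE -(wt0 _ (fY i)) /wt (bigD1 i) //=.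
rewrite big1 ?addr0 // => j /andP[/eqP/val_inj/fi ->].
by rewrite eqxx.
Qed.

Definition form (a : 'cV[R]_d.+1) x : R := (homog x *m a) 0 0.

Lemma formN a x : form (- a) x = - form a x.
Proof. by rewrite /form mulmxN mxE. Qed.

Lemma form_conv a t x y : form a (t *: x + (1 - t) *: y) = t * form a x + (1 - t) * form a y.
Proof.
rewrite /form (_ : homog _ = t *: homog x + (1 - t) *: homog y).
  by rewrite mulmxDl -!scalemxAl !mxE.
by apply/rowP=> j; rewrite !mxE; case: unlift => [i|]; rewrite ?mxE //; ring.
Qed.

(** The open half-space is convex, so it contains the smallest convex set around [Y]. *)
Lemma conv_hull_pos a Y : (forall y, y \in Y -> 0 < form a y) ->
  forall x, conv_hull [set` Y]%classic x -> 0 < form a x.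
Proof.
move=> Ypos x /(_ [set y | 0 < form a y]%classic); apply; split; last first.
  by move=> y; apply: Ypos.
move=> u v t; rewrite !inE /= => u0 v0.
exact: (eq_ind_r (fun r => 0 < r) (convR_gt0 t u0 v0) (form_conv a _ u v)).
Qed.

Lemma card_fset_classes X (P : pred V) :
  #|` [fset x in X | P x]%fset| = #|[set q : X | P (val q)]|.
Proof.
rewrite card_fset_sum1 -sum1_card big_fset /= big_seq_fsetE /=.
by apply: eq_bigl => q; rewrite inE.
Qed.

(* The parts of the partition are the fibres of [l], which makes them disjoint
   and exhaust [X] by construction. *)
Lemma labelling n X (c : V -> 'I_d) : (0 < n)%N -> general_position X ->
  #|` X| = (d.+1 * n)%N -> (forall i, n <= #|` [fset x in X | c x == i]%fset|)%N ->
  exists l : V -> nat, let Y k := [fset x in X | l x == k]%fset in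
    [/\ forall x, x \in X -> (l x < n)%N,
      forall k, (k < n)%N -> #|` Y k| = d.+1,
      forall k i, (k < n)%N -> exists2 x, x \in Y k & c x = i &
      forall k k', (k < n)%N -> (k' < n)%N -> k != k' ->
        forall x, conv_hull [set` Y k]%classic x -> conv_hull [set` Y k']%classic x -> False].
Proof.
have [m] := ubnP n; elim: m n X => // m IH n X; rewrite ltnS => nm n0 gX cX cls.
have [n1|n1] := leqP n 1.
  have nE : n = 1%N by lia.
  exists (fun=> 0%N) => Y; split=> // [k|k i|k k'].
  - rewrite nE ltnS leqn0 => /eqP->.
    have -> : Y 0%N = X by apply/fsetP=> x; rewrite !inE /= andbT.
    by rewrite cX nE muln1.
  - rewrite nE ltnS leqn0 => /eqP->.
    have := leq_trans n0 (cls i); rewrite cardfs_gt0 => /fset0Pn[x].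
    by rewrite !inE => /andP[xX /eqP cx]; exists x; rewrite ?inE ?xX.
  by rewrite nE !ltnS !leqn0 => /eqP-> /eqP->.
have cXI : #|{: X}| = (d.+1 * n)%N by rewrite -cX cardfE.
have [|a [aN aP aC]] := @splitting_form R X d (c \o val) _ n (general_position_genpos gX) n0 cXI.
  by move=> i; have := cls i; rewrite card_fset_classes.
have aE q : val_form [ffun q : X => homog (val q)] a q = form a (val q).
  by rewrite /val_form ffunE.
have fN x : x \in X -> ~~ (0 < form a x) = (form a x < 0).
  by move=> xX; have := aN [` xX]%fset; rewrite aE /=; case: ltrgt0P.
pose A := [fset x in X | 0 < form a x]%fset.
pose B := [fset x in X | form a x < 0]%fset.
have gsub Z : (Z `<=` X)%fset -> general_position Z.
  by move=> ZX Y YZ; apply: gX; apply: fsubset_trans ZX.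
have nE : (n = n./2 + uphalf n)%N by rewrite addnC uphalf_half; lia.
have h0 : (0 < n./2)%N by lia.
have cA : #|` A| = (d.+1 * n./2)%N.
  by rewrite card_fset_classes -aP; apply: eq_card => q; rewrite !inE aE.
have cB : #|` B| = (d.+1 * uphalf n)%N.
  have := cardsC [set q | 0 < val_form [ffun q : X => homog (val q)] a q].
  rewrite aP cXI card_fset_classes {2}nE mulnDr => /addnI <-.
  by apply: eq_card => q; rewrite !inE aE fN ?(fsvalP q).
have [|||||lA [lAn lAc lAi lAd]] := IH n./2 A; rewrite ?h0 //.
- by lia.
- by apply: gsub; apply: fset_sub.
- move=> i; apply: leq_trans (aC i).1 _; rewrite (_ : [fset x in A | c x == i]%fset =
    [fset x in X | (c x == i) && (0 < form a x)]%fset).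
    rewrite card_fset_classes; apply: eq_leq; apply: eq_card => q.
    by rewrite !inE aE.
  by apply/fsetP=> x; rewrite !inE -andbA; congr (_ && _); rewrite andbC.
have [|||||lB [lBn lBc lBi lBd]] := IH (uphalf n) B; rewrite ?h0 //.
- by lia.
- by lia.
- by apply: gsub; apply: fset_sub.
- move=> i; apply: leq_trans (aC i).2 _; rewrite (_ : [fset x in B | c x == i]%fset =
    [fset x in X | (c x == i) && (form a x < 0)]%fset).
    rewrite card_fset_classes; apply: eq_leq; apply: eq_card => q.
    by rewrite !inE aE.
  by apply/fsetP=> x; rewrite !inE -andbA; congr (_ && _); rewrite andbC.
(* Labels of the negative side are shifted past the [n./2] labels of the positive side. *)
exists (fun x => if 0 < form a x then lA x else (n./2 + lB x)%N) => Y.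
have inA x : (x \in A) = (x \in X) && (0 < form a x) by rewrite !inE.
have inB x : (x \in B) = (x \in X) && (form a x < 0) by rewrite !inE.
have YA k : (k < n./2)%N -> Y k = [fset x in A | lA x == k]%fset.
  move=> kn; apply/fsetP=> x; rewrite !inE; case: (x \in X) => //=.
  by case: ifP => //= _; apply/eqP; lia.
have YB k : (n./2 <= k)%N -> Y k = [fset x in B | lB x == (k - n./2)%N]%fset.
  move=> kn; apply/fsetP=> x; rewrite !inE; have [xX|//] /= := boolP (x \in X).
  rewrite -fN //; case: ifP => /= fx; last by apply/eqP/eqP; lia.
  by have := lAn x; rewrite inA xX fx => /(_ isT) ?; apply/eqP; lia.
have posA k y : y \in [fset x in A | lA x == k]%fset -> 0 < form a y.
  by rewrite !inE => /andP[/andP[]].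
have negB k y : y \in [fset x in B | lB x == k]%fset -> 0 < form (- a) y.
  by rewrite !inE formN oppr_gt0 => /andP[/andP[]].
have sep k k' x : (k < n./2)%N -> (n./2 <= k')%N ->
    conv_hull [set` Y k]%classic x -> conv_hull [set` Y k']%classic x -> False.
  move=> kn kn'; rewrite (YA _ kn) (YB _ kn') => /(conv_hull_pos (@posA _)) fx.
  by move/(conv_hull_pos (@negB _)); rewrite formN oppr_gt0 ltNge (ltW fx).
split.
- move=> x xX; case: ifP => fx.
    by have := lAn x; rewrite inA xX fx => /(_ isT); lia.
  by have := lBn x; rewrite inB xX -fN // fx => /(_ isT); lia.
- move=> k kn; have [kn2|kn2] := ltnP k n./2; first by rewrite YA ?lAc.
  by rewrite YB ?lBc //; lia.
- move=> k i kn; have [kn2|kn2] := ltnP k n./2; first by rewrite YA //; apply: lAi.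
  by rewrite YB //; apply: lBi; lia.
move=> k k' kn kn' kk x; have [kn2|kn2] := ltnP k n./2; have [kn2'|kn2'] := ltnP k' n./2.
- by rewrite !YA //; apply: lAd.
- exact: sep.
- by move=> h h'; apply: sep h' h.
by rewrite !YB //; apply: lBd; lia.
Qed.

End Splitting.

(** * The islands *)

Theorem theorem2 (R : realType) (d n : nat) (hd : (2 <= d)%N) (hn : (1 <= n)%N)
    (X : {fset 'rV[R]_d}) (C : 'I_d -> {fset 'rV[R]_d})
    (hX : general_position X) (hC : coloring C X)
    (hcard : #|` X|%fset = (d.+1 * n)%N)
    (hclass : forall i : 'I_d, (n <= #|` C i|%fset)%N) :
  exists Y : 'I_n -> {fset 'rV[R]_d},
    (forall i : 'I_n, k_island d.+1 X (Y i) /\ colorful d C (Y i)) /\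
    trivIset setT (fun i : 'I_n => conv_hull [set` Y i]%classic).
Proof.
case: hC => Cdisj Ccov.
have CX i x : x \in C i -> x \in X.
  move=> xi; suff : [set` X]%classic x by [].
  by rewrite -Ccov; exists i.
have Cu i j x : x \in C i -> x \in C j -> i = j.
  by move=> xi xj; apply: (Cdisj i j) => //; exists x.
have i0 : 'I_d by exists 0; apply: leq_trans hd.
(* The default [i0] is never reached on [X], which the classes cover. *)
pose c (x : 'rV[R]_d) := odflt i0 [pick i | x \in C i].
have cP i x : x \in X -> (c x == i) = (x \in C i).
  move=> xX; rewrite /c; case: pickP => [j xj|none] /=.
    by apply/eqP/idP => [<-//|xi]; apply: Cu xj xi.
  have [j _ xj] : (\bigcup_k [set` C k])%classic x by rewrite Ccov.
  by move: (none j); rewrite /= xj.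
have [|l [ln lc li ld]] := labelling hn hX hcard (c := c).
  move=> i; rewrite (_ : [fset x in X | c x == i]%fset = C i) //.
  apply/fsetP=> x; rewrite !inE; apply/andP/idP => [[xX]|xi]; first by rewrite cP.
  by have xX := CX _ _ xi; rewrite cP.
pose Y k := [fset x in X | l x == k]%fset.
exists (fun k : 'I_n => Y (val k)); split=> [k|j k _ _ [x [xj xk]]]; last first.
  by apply/val_inj/eqP/negPn/negP => jk; apply: (ld j k _ _ jk x).
have sub_hull (k' : nat) x : x \in Y k' -> conv_hull [set` Y k']%classic x.
  by move=> xY A [_]; apply.
split; [split; [split|]|].
- exact: fset_sub.
- rewrite eqEsubset; split=> x /=; last first.
    by move=> xY; split; [move: xY; rewrite !inE => /andP[]|apply: sub_hull].
  (* A point of [X] in the hull of [Y k] with another label would also lie in the hull of its own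
     part, against disjointness. *)
  case=> xX xk; rewrite !inE xX /=; apply/negPn/negP => lk.
  by apply: (ld (l x) k _ _ lk x) => //; [exact: ln|apply: sub_hull; rewrite !inE xX eqxx].
- exact: lc (ltn_ord k).
rewrite /colorful -[X in (X <= _)%N](card_ord d); apply/eq_leq/eq_card => i.
rewrite !inE; apply/esym/fset0Pn; have [x xY <-] := li k i (ltn_ord k).
by exists x; rewrite inE xY -cP ?eqxx //; move: xY; rewrite !inE => /andP[].
Qed.
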